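(* Let $T>0$, let $N_T\ge 1$ be an integer, $\Delta t=T/N_T$ and $t_k=k\Delta t$ for $0\le k\le N_T$. Suppose that $h\in C^2[0,T]$ is real-valued. For any $0<\alpha<1$, let $$R_k:={}_0^{\mathrm{CF}}D_t^{\alpha}h(t_k)-F_t^{\alpha}h^k .$$ Then $$|R_k|\le \frac{\alpha\, T\,\max_{t\in[0,T]}|h''(t)|}{8(1-\alpha)^2}\,(\Delta t)^2,\qquad k=1,2,\dots,N_T .$$
   Context: Write $h^k:=h(t_k)$. The Caputo-Fabrizio derivative of order $\alpha\in(0,1)$ of $h$ is $${}_0^{\mathrm{CF}}D_t^{\alpha}h(t)=\frac{1}{1-\alpha}\int_0^t h'(s)\exp\left(-\alpha\frac{t-s}{1-\alpha}\right)\mathrm{d}s .$$ The discrete fractional differential operator $F_t^{\alpha}$ is defined recursively by $$F_t^{\alpha}h^1=\frac{1}{1-\alpha}\,\frac{h^1-h^0}{\Delta t}\int_0^{t_1}\exp\left(-\alpha\frac{t_1-s}{1-\alpha}\right)\mathrm{d}s,$$ $$F_t^{\alpha}h^k=\exp\left(-\frac{\alpha\Delta t}{1-\alpha}\right)F_t^{\alpha}h^{k-1}+\frac{1}{1-\alpha}\,\frac{h^k-h^{k-1}}{\Delta t}\int_{t_{k-1}}^{t_k}\exp\left(-\alpha\frac{t_k-s}{1-\alpha}\right)\mathrm{d}s,\qquad 2\le k\le N_T .$$ *)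

(* Defs.v *)
From Stdlib Require Import Reals.
From Coquelicot Require Import Coquelicot.
Open Scope R_scope.

Definition Icc (a b x : R) : Prop := a <= x <= b.

(** Functions on [[a,b]] are represented by total functions on [R] whose values
    outside [[a,b]] play no role; derivatives are therefore taken within [[a,b]],
    hence are one-sided at the endpoints. *)
Definition derive_on (a b : R) (h : R -> R) (x : R) : R :=
  iota (fun l : R => D_in h (fun _ => l) (Icc a b) x).

(** For [a < b] and [x] in [[a,b]], [D_in f (derive_on a b f) (Icc a b) x] holds
    exactly when [f] is differentiable at [x] within [[a,b]]. Continuity of [h]
    and of its first derivative follows from differentiability. *)
Definition C2_on (a b : R) (h : R -> R) : Prop :=
  let h' := derive_on a b h in
  let h'' := derive_on a b h' in
  forall x, Icc a b x ->
    D_in h h' (Icc a b) x /\ D_in h' h'' (Icc a b) x /\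
    continue_in h'' (Icc a b) x.

Definition is_max_on (a b : R) (f : R -> R) (M : R) : Prop :=
  (exists t, Icc a b t /\ f t = M) /\ (forall t, Icc a b t -> f t <= M).

Definition max_on (a b : R) (f : R -> R) : R :=
  iota (fun M : R => is_max_on a b f M).

(** [T] is the right end of the interval [[0,T]] on which [h] is given. *)
Definition CF_derivative (T alpha : R) (h : R -> R) (t : R) : R :=
  1 / (1 - alpha) *
  RInt (fun s => derive_on 0 T h s * exp (- alpha * ((t - s) / (1 - alpha)))) 0 t.

Definition grid (dt : R) (k : nat) : R := INR k * dt.

(** The operator is only meaningful for [k >= 1]; the value at [k = 0] is a
    dummy that the recursion never uses. *)
Fixpoint F_discrete (alpha dt : R) (h : R -> R) (k : nat) : R :=
  match k with
  | O => 0
  | S O =>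
      1 / (1 - alpha) * ((h (grid dt 1) - h (grid dt 0)) / dt) *
      RInt (fun s => exp (- alpha * ((grid dt 1 - s) / (1 - alpha)))) 0 (grid dt 1)
  | S (S _ as j) =>
      exp (- (alpha * dt / (1 - alpha))) * F_discrete alpha dt h j +
      1 / (1 - alpha) * ((h (grid dt k) - h (grid dt j)) / dt) *
      RInt (fun s => exp (- alpha * ((grid dt k - s) / (1 - alpha))))
        (grid dt j) (grid dt k)
  end.

(* Main.v *)
Require Import Defs.
From Stdlib Require Import Reals Lra Lia.
From Coquelicot Require Import Coquelicot.
Open Scope R_scope.

(** The residual satisfies the same recursion as [F_discrete]: [R_(k+1)] is
    [exp (- alpha dt / (1 - alpha)) R_k] plus [1 / (1 - alpha)] times the
    integral over the last cell of [(h - p)'] against the kernel, [p] being the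
    linear interpolant of [h] on that cell. As [h - p] vanishes at both ends of the cell, integration by
    parts moves the derivative to the kernel, at the cost of a factor
    [alpha / (1 - alpha)], and the classical bound [|h - p| <= M dt^2 / 8]
    shows that every step adds at most
    [alpha / (1 - alpha)^2 * (M dt^2 / 8) * dt]. *)

(** * Extension of functions from a closed interval to the real line *)

Definition clamp (a b x : R) : R := Rmax a (Rmin b x).

Lemma clamp_Icc (a b x : R) : a <= b -> Icc a b (clamp a b x).
Proof.
  unfold Icc, clamp, Rmax, Rmin; intros; repeat destruct Rle_dec; lra.
Qed.

Lemma clamp_id (a b x : R) : Icc a b x -> clamp a b x = x.
Proof.
  unfold Icc, clamp, Rmax, Rmin; intros; repeat destruct Rle_dec; lra.
Qed.

Lemma clamp_contract (a b x y : R) :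
  a <= b -> Rabs (clamp a b y - clamp a b x) <= Rabs (y - x).
Proof.
  unfold clamp, Rmax, Rmin, Rabs; intros.
  repeat destruct Rle_dec; repeat destruct Rcase_abs; lra.
Qed.

Lemma continuous_clamp (f : R -> R) (a b : R) :
  a <= b -> (forall x, Icc a b x -> continue_in f (Icc a b) x) ->
  forall x, continuous (fun y => f (clamp a b y)) x.
Proof.
  intros Hab Hf x.
  apply continuity_pt_filterlim; intros eps Heps.
  destruct (Hf _ (clamp_Icc a b x Hab) eps Heps) as [d [Hd Hlim]].
  exists d; split; [exact Hd|]; intros y [_ Hy].
  (* [continue_in] speaks only of points other than the base point, so the case where both clamps
     coincide is settled separately. *)
  destruct (Req_dec (clamp a b x) (clamp a b y)) as [E|E].
  - rewrite E; simpl; unfold Rdist; rewrite Rminus_diag, Rabs_R0; exact Heps.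
  - apply Hlim; split; [split; [apply clamp_Icc|]; assumption|].
    apply Rle_lt_trans with (2 := Hy); apply clamp_contract; exact Hab.
Qed.

Lemma is_derive_D_in (f df : R -> R) (a b x : R) :
  a < x < b -> D_in f df (Icc a b) x -> is_derive f x (df x).
Proof.
  intros Hx Hd; apply is_derive_Reals; intros eps Heps.
  destruct (Hd eps Heps) as [d [Hdpos Hlim]].
  assert (Hm : 0 < Rmin d (Rmin (x - a) (b - x)))
    by (repeat apply Rmin_pos; lra).
  exists (mkposreal _ Hm); simpl; intros y Hy0 Hy.
  pose proof (Rmin_l d (Rmin (x - a) (b - x))).
  pose proof (Rmin_r d (Rmin (x - a) (b - x))).
  pose proof (Rmin_l (x - a) (b - x)).
  pose proof (Rmin_r (x - a) (b - x)).
  destruct (Rabs_def2 y _ Hy) as [Hy1 Hy2].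
  specialize (Hlim (x + y)); simpl in Hlim; unfold Rdist in Hlim.
  replace (x + y - x) with y in Hlim by ring.
  apply Hlim; repeat split; lra.
Qed.

Lemma is_derive_continuity_pt (f : R -> R) (x l : R) :
  is_derive f x l -> continuity_pt f x.
Proof.
  intros Df; apply derivable_continuous_pt; exists l; apply is_derive_Reals, Df.
Qed.

(** Composing [f] with [clamp] would destroy differentiability at the endpoints. The antiderivative
    of [g] starting from [f a] is used instead: it is differentiable everywhere, and its difference
    from [f] has zero derivative inside the interval. *)
Lemma D_in_extension (f df g : R -> R) (a b : R) :
  a < b -> (forall x, Icc a b x -> D_in f df (Icc a b) x) ->
  (forall x, continuous g x) -> (forall x, Icc a b x -> g x = df x) ->
  exists F : R -> R, (forall x, is_derive F x (g x)) /\
    (forall x, Icc a b x -> F x = f x).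
Proof.
  intros Hab Hf Hg Hgf.
  assert (HF : forall x, is_derive (fun y => f a + RInt g a y) x (g x)).
  { intros x; replace (g x) with (plus 0 (g x)) by apply Rplus_0_l.
    apply (is_derive_plus (fun _ => f a) (fun y => RInt g a y));
      [apply (is_derive_const (f a))|].
    apply is_derive_RInt with (a := a); [|apply Hg].
    apply filter_forall; intros y; apply (RInt_correct (V := R_CompleteNormedModule)).
    apply (ex_RInt_continuous (V := R_CompleteNormedModule)); intros; apply Hg. }
  exists (fun y => f a + RInt g a y); split; [exact HF|].
  intros x Hx; unfold Icc in Hx.
  (* The mean value theorem needs two-sided continuity up to the endpoints, whereas [f] is only
     controlled within the interval; hence the clamp. *)
  pose (D := fun y => f (clamp a b y) - (f a + RInt g a y)).
  assert (HD : forall y, continuity_pt D y).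
  { intros y; apply continuity_pt_minus.
    - apply continuity_pt_filterlim; apply continuous_clamp; [lra|].
      intros z Hz; exact (cont_deriv _ _ _ _ (Hf z Hz)).
    - apply is_derive_continuity_pt with (1 := HF y). }
  destruct (MVT_gen D a x (fun _ => 0)) as [c [_ Hc]].
  - rewrite Rmin_left, Rmax_right by lra; intros y Hy.
    replace 0 with (minus (df y) (g y)).
    2:{ rewrite Hgf by (unfold Icc; lra); apply Rminus_diag. }
    apply (is_derive_minus (fun y => f (clamp a b y)) (fun y => f a + RInt g a y));
      [|apply HF].
    apply is_derive_ext_loc with f.
    + apply (locally_interval _ y a b); simpl; try lra.
      intros z Hz1 Hz2; rewrite clamp_id; [reflexivity|unfold Icc; simpl in *; lra].
    + apply is_derive_D_in with a b; [lra|]. apply Hf; unfold Icc; lra.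
  - intros; apply HD.
  - unfold D in Hc; rewrite !clamp_id, RInt_point in Hc by (unfold Icc; lra).
    change (zero : R) with 0 in Hc; lra.
Qed.

(** The extension is built from the top: the second derivative is continued by constants, then
    integrated twice. Afterwards all calculus is done with two-sided derivatives on the whole
    line. *)
Lemma C2_on_extension (a b : R) (h : R -> R) :
  a < b -> C2_on a b h ->
  exists f f' f'' : R -> R,
    (forall x, is_derive f x (f' x)) /\ (forall x, is_derive f' x (f'' x)) /\
    (forall x, continuous f'' x) /\
    (forall x, Icc a b x ->
       f x = h x /\ f' x = derive_on a b h x /\
       f'' x = derive_on a b (derive_on a b h) x).
Proof.
  intros Hab Hh.
  pose (f'' := fun x => derive_on a b (derive_on a b h) (clamp a b x)).
  assert (Hc : forall x, continuous f'' x)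
    by (apply continuous_clamp; [lra|apply Hh]).
  assert (He : forall x, Icc a b x -> f'' x = derive_on a b (derive_on a b h) x)
    by (intros x Hx; unfold f''; rewrite clamp_id by exact Hx; reflexivity).
  destruct (D_in_extension (derive_on a b h) _ f'' a b Hab
              (fun x Hx => proj1 (proj2 (Hh x Hx))) Hc He) as [f' [Df' Ef']].
  destruct (D_in_extension h (derive_on a b h) f' a b Hab
              (fun x Hx => proj1 (Hh x Hx))) as [f [Df Ef]].
  - intros x; apply continuity_pt_filterlim.
    apply is_derive_continuity_pt with (1 := Df' x).
  - exact Ef'.
  - exists f, f', f''; auto 8.
Qed.

(** [iota] is determined only under unique existence; two maxima bound each other, so existence
    suffices. *)
Lemma max_on_correct (a b : R) (f : R -> R) :
  (exists M, is_max_on a b f M) -> is_max_on a b f (max_on a b f).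
Proof.
  intros [M HM]; unfold max_on.
  apply (iota_correct (is_max_on a b f)); exists M; split; [exact HM|].
  destruct HM as [[t [Ht <-]] HM]; intros M' [[t' [Ht' <-]] HM'].
  apply Rle_antisym; auto.
Qed.

(** * Error of linear interpolation *)

Lemma convex_nonpos (f f' f'' : R -> R) (a b x : R) :
  (forall y, is_derive f y (f' y)) -> (forall y, is_derive f' y (f'' y)) ->
  (forall y, a <= y <= b -> 0 <= f'' y) -> f a = 0 -> f b = 0 ->
  a <= x <= b -> f x <= 0.
Proof.
  intros Df Df' Hpos Ha Hb Hx.
  assert (mvt : forall g g' u v, (forall y, is_derive g y (g' y)) -> u <= v ->
            exists c, u <= c <= v /\ g v - g u = g' c * (v - u)).
  { intros g g' u v Dg Huv; destruct (MVT_gen g u v g') as [c Hc].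
    - intros; apply Dg.
    - intros y _; apply is_derive_continuity_pt with (1 := Dg y).
    - rewrite Rmin_left, Rmax_right in Hc by lra; eauto. }
  destruct (mvt f f' a x Df) as [c1 [Hc1 E1]]; [lra|].
  destruct (mvt f f' x b Df) as [c2 [Hc2 E2]]; [lra|].
  destruct (mvt f' f'' c1 c2 Df') as [c3 [Hc3 E3]]; [lra|].
  specialize (Hpos c3 ltac:(lra)).
  (* A positive value at [x] would force a positive slope at [c1] to the left and a negative one at
     [c2] to the right, although the slope does not decrease from [c1] to [c2]. *)
  destruct (Rle_lt_dec (f x) 0) as [|Hfx]; [assumption|exfalso].
  assert (0 < f' c1) by nra.
  assert (f' c2 < 0) by nra.
  nra.
Qed.

Lemma linear_interpolation_upper (f f' f'' : R -> R) (a b M x : R) :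
  a < b -> 0 <= M ->
  (forall y, is_derive f y (f' y)) -> (forall y, is_derive f' y (f'' y)) ->
  (forall y, a <= y <= b -> - M <= f'' y) -> a <= x <= b ->
  f x - (f a + (f b - f a) / (b - a) * (x - a)) <= M / 8 * (b - a) ^ 2.
Proof.
  intros Hab HM0 Df Df' HM Hx.
  set (d := (f b - f a) / (b - a)).
  (* Adding [M/2 (y-a)(y-b)] makes the interpolation error convex. *)
  assert (H : f x - (f a + d * (x - a)) + M / 2 * ((x - a) * (x - b)) <= 0).
  { apply (convex_nonpos
      (fun y => f y - (f a + d * (y - a)) + M / 2 * ((y - a) * (y - b)))
      (fun y => f' y - d + M / 2 * (2 * y - a - b))
      (fun y => f'' y + M) a b); try assumption.
    - intros y; auto_derive; [eexists; apply Df|].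
      rewrite (is_derive_unique (fun y : R => f y) _ _ (Df y)); field.
    - intros y; auto_derive; [eexists; apply Df'|].
      rewrite (is_derive_unique (fun y : R => f' y) _ _ (Df' y)); field.
    - intros y Hy; specialize (HM y Hy); lra.
    - ring.
    - unfold d; field; lra. }
  (* The constant 1/8 is 1/2 times 1/4: 4(x-a)(b-x) = (b-a)^2 - (2x-a-b)^2 is at most (b-a)^2. *)
  assert (0 <= (2 * x - a - b) ^ 2) by apply pow2_ge_0; nra.
Qed.

Lemma linear_interpolation_error (f f' f'' : R -> R) (a b M x : R) :
  a < b ->
  (forall y, is_derive f y (f' y)) -> (forall y, is_derive f' y (f'' y)) ->
  (forall y, a <= y <= b -> Rabs (f'' y) <= M) -> a <= x <= b ->
  Rabs (f x - (f a + (f b - f a) / (b - a) * (x - a))) <= M / 8 * (b - a) ^ 2.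
Proof.
  intros Hab Df Df' HM Hx.
  assert (HM0 : 0 <= M)
    by (apply Rle_trans with (2 := HM x Hx); apply Rabs_pos).
  assert (HM' : forall y, a <= y <= b -> - M <= f'' y <= M)
    by (intros; apply Rabs_le_between; auto).
  pose proof (linear_interpolation_upper f f' f'' a b M x Hab HM0 Df Df'
                (fun y Hy => proj1 (HM' y Hy)) Hx) as Hup.
  (* The lower bound is the upper bound for [- f]. *)
  pose proof (linear_interpolation_upper (fun y => - f y) (fun y => - f' y)
    (fun y => - f'' y) a b M x Hab HM0
    (fun y => is_derive_opp f y _ (Df y)) (fun y => is_derive_opp f' y _ (Df' y))
    ltac:(intros y Hy; specialize (HM' y Hy); lra) Hx) as Hlow.
  cbv beta in Hlow.
  replace (- f x - (- f a + (- f b - - f a) / (b - a) * (x - a)))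
    with (- (f x - (f a + (f b - f a) / (b - a) * (x - a)))) in Hlow
    by (field; lra).
  apply Rabs_le_between; lra.
Qed.

(** * Residual on a single cell *)

Lemma exp_nonpos_bounds (x : R) : x <= 0 -> 0 < exp x <= 1.
Proof.
  intros Hx; split; [apply exp_pos|]; rewrite <- exp_0.
  destruct (Rle_lt_or_eq_dec _ _ Hx) as [H | ->]; [|apply Rle_refl].
  apply Rlt_le, exp_increasing, H.
Qed.

Lemma cell_residual (f f' f'' : R -> R) (a b M alpha : R) :
  0 < alpha < 1 -> a < b ->
  (forall y, is_derive f y (f' y)) -> (forall y, is_derive f' y (f'' y)) ->
  (forall y, a <= y <= b -> Rabs (f'' y) <= M) ->
  Rabs (RInt (fun s => f' s * exp (- alpha * ((b - s) / (1 - alpha)))) a b -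
        (f b - f a) / (b - a) *
        RInt (fun s => exp (- alpha * ((b - s) / (1 - alpha)))) a b) <=
    (b - a) * (alpha / (1 - alpha) * (M / 8 * (b - a) ^ 2)).
Proof.
  intros Ha Hab Df Df' HM.
  set (K := fun s => exp (- alpha * ((b - s) / (1 - alpha)))).
  set (d := (f b - f a) / (b - a)).
  set (c := alpha / (1 - alpha)).
  set (u := fun s => f s - (f a + d * (s - a))).
  assert (Hc : 0 < c) by (apply Rdiv_lt_0_compat; lra).
  assert (CK : forall s, continuous K s).
  { intros s; apply (ex_derive_continuous K); unfold K; auto_derive; exact I. }
  assert (Cf' : forall s, continuous f' s)
    by (intros s; apply (ex_derive_continuous f'); eexists; apply Df').
  assert (Cu : forall s, continuous u s).
  { intros s; apply (ex_derive_continuous u); unfold u; auto_derive.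
    eexists; apply Df. }
  assert (IK : ex_RInt K a b)
    by (apply (ex_RInt_continuous K); intros; apply CK).
  assert (IfK : ex_RInt (fun s => f' s * K s) a b).
  { apply (ex_RInt_continuous (fun s => f' s * K s)); intros.
    apply (continuous_mult f' K); auto. }
  assert (IuK : ex_RInt (fun s => c * (u s * K s)) a b).
  { apply (ex_RInt_continuous (fun s => c * (u s * K s))); intros.
    apply (continuous_mult (fun _ => c)); [apply continuous_const|].
    apply (continuous_mult u K); auto. }
  (* Integration by parts: since [K] has derivative [c * K] and [u] has derivative [f' - d], the
     integrand is the derivative of [u * K]. *)
  assert (Hparts : is_RInt (fun s => (f' s * K s - d * K s) + c * (u s * K s)) a b
                     (u b * K b - u a * K a)).
  { apply (is_RInt_derive (fun s => u s * K s)
             (fun s => (f' s * K s - d * K s) + c * (u s * K s))).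
    - intros s _; unfold u, K; auto_derive; [eexists; apply Df|].
      rewrite (is_derive_unique (fun y : R => f y) _ _ (Df s)); unfold c, Rdiv, Rminus.
      field; lra.
    - intros s _.
      apply (continuous_plus (fun s => f' s * K s - d * K s)
               (fun s => c * (u s * K s))).
      + apply (continuous_minus (fun s => f' s * K s) (fun s => d * K s)).
        * apply (continuous_mult f' K); auto.
        * apply (continuous_mult (fun _ => d)); [apply continuous_const|auto].
      + apply (continuous_mult (fun _ => c)); [apply continuous_const|].
        apply (continuous_mult u K); auto. }
  assert (Hu0 : u b * K b - u a * K a = 0) by (unfold u, d; field; lra).
  rewrite Hu0 in Hparts.
  assert (Hsplit : is_RInt (fun s => (f' s * K s - d * K s) + c * (u s * K s)) a b
     ((RInt (fun s => f' s * K s) a b - d * RInt K a b)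
       + RInt (fun s => c * (u s * K s)) a b)).
  { apply (is_RInt_plus (fun s => f' s * K s - d * K s) (fun s => c * (u s * K s))).
    - apply (is_RInt_minus (fun s => f' s * K s) (fun s => d * K s)).
      + apply (RInt_correct (fun s => f' s * K s)), IfK.
      + apply (is_RInt_scal K), (RInt_correct K), IK.
    - apply (RInt_correct (fun s => c * (u s * K s))), IuK. }
  pose proof (is_RInt_unique (V := R_CompleteNormedModule) _ _ _ _ Hparts) as Hsum.
  rewrite (is_RInt_unique (V := R_CompleteNormedModule) _ _ _ _ Hsplit) in Hsum.
  change (Rabs (RInt (fun s => f' s * K s) a b - d * RInt K a b) <=
          (b - a) * (c * (M / 8 * (b - a) ^ 2))).
  replace (RInt (fun s => f' s * K s) a b - d * RInt K a b)
    with (- RInt (fun s => c * (u s * K s)) a b) by lra.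
  rewrite Rabs_Ropp; apply abs_RInt_le_const; [lra|exact IuK|].
  intros s Hs.
  assert (HK : 0 < K s <= 1).
  { apply exp_nonpos_bounds.
    assert (0 <= (b - s) / (1 - alpha)) by (apply Rdiv_le_0_compat; lra); nra. }
  pose proof (linear_interpolation_error f f' f'' a b M s Hab Df Df' HM Hs) as Hus.
  fold d in Hus; change (f s - (f a + d * (s - a))) with (u s) in Hus.
  rewrite !Rabs_mult, (Rabs_pos_eq c), (Rabs_pos_eq (K s)) by lra.
  apply Rmult_le_compat_l; [lra|].
  pose proof (Rabs_pos (u s)); nra.
Qed.

(** * Recursions in time and accumulation of the error *)

Lemma F_discrete_S (alpha dt : R) (h : R -> R) (k : nat) :
  F_discrete alpha dt h (S k) =
    exp (- (alpha * dt / (1 - alpha))) * F_discrete alpha dt h k +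
    1 / (1 - alpha) * ((h (grid dt (S k)) - h (grid dt k)) / dt) *
    RInt (fun s => exp (- alpha * ((grid dt (S k) - s) / (1 - alpha))))
      (grid dt k) (grid dt (S k)).
Proof.
  (* The dummy value 0 at [k = 0] cancels the memory term, so the first step also obeys the general
     recursion. *)
  destruct k as [|k]; [|reflexivity]; simpl F_discrete.
  replace (grid dt 0) with 0 by (unfold grid; simpl; ring); ring.
Qed.

(** The exponential turns a shift of the evaluation time from [t] to [u] into a constant factor on
    the whole history. This gives the exact derivative the same recursion as the discrete
    operator. *)
Lemma kernel_RInt_shift (g : R -> R) (alpha a t u : R) :
  (forall x, continuous g x) ->
  RInt (fun s => g s * exp (- alpha * ((u - s) / (1 - alpha)))) a u =
    exp (- (alpha * (u - t) / (1 - alpha))) *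
      RInt (fun s => g s * exp (- alpha * ((t - s) / (1 - alpha)))) a t +
    RInt (fun s => g s * exp (- alpha * ((u - s) / (1 - alpha)))) t u.
Proof.
  intros Hg.
  assert (I : forall v x y,
    ex_RInt (fun s => g s * exp (- alpha * ((v - s) / (1 - alpha)))) x y).
  { intros v x y.
    apply (ex_RInt_continuous
      (fun s => g s * exp (- alpha * ((v - s) / (1 - alpha))))).
    intros; apply (continuous_mult g); [apply Hg|].
    apply (ex_derive_continuous (fun s => exp (- alpha * ((v - s) / (1 - alpha))))).
    auto_derive; exact I. }
  rewrite <- (RInt_Chasles _ a t u (I u a t) (I u t u)).
  apply (f_equal2 Rplus); [|reflexivity].
  rewrite <- (RInt_scal _ a t _ (I t a t)).
  apply RInt_ext; intros s _; unfold scal; simpl; unfold mult; simpl.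
  replace (- alpha * ((u - s) / (1 - alpha)))
    with (- (alpha * (u - t) / (1 - alpha)) + - alpha * ((t - s) / (1 - alpha)))
    by (unfold Rdiv; ring).
  rewrite exp_plus; ring.
Qed.

Theorem lemma2p1 (T : R) (N : nat) (h : R -> R) (alpha : R)
  (hT : 0 < T) (hN : (1 <= N)%nat) (hh : C2_on 0 T h)
  (halpha : 0 < alpha < 1) :
  let dt := T / INR N in
  let Rk := fun k : nat =>
    CF_derivative T alpha h (grid dt k) - F_discrete alpha dt h k in
  forall k : nat, (1 <= k <= N)%nat ->
    Rabs (Rk k) <=
      alpha * T * max_on 0 T (fun t => Rabs (derive_on 0 T (derive_on 0 T h) t))
        / (8 * (1 - alpha) ^ 2) * dt ^ 2.
Proof.
  intros dt Rk.
  destruct (C2_on_extension 0 T h hT hh) as (f & f' & f'' & Df & Df' & Cf'' & E).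
  set (M := max_on 0 T _).
  assert (HM : is_max_on 0 T
            (fun t => Rabs (derive_on 0 T (derive_on 0 T h) t)) M).
  { apply max_on_correct.
    (* The extreme value theorem is applied to the extension [f''], which is continuous in the
       two-sided sense at 0 and [T] too. *)
    destruct (continuity_ab_maj (fun t => Rabs (f'' t)) 0 T) as [x [Hx1 Hx2]].
    - lra.
    - intros c _; apply (continuity_pt_comp f'' Rabs); [|apply Rcontinuity_abs].
      apply continuity_pt_filterlim, Cf''.
    - exists (Rabs (f'' x)); split.
      + exists x; split; [exact Hx2|].
        destruct (E x Hx2) as (_ & _ & ->); reflexivity.
      + intros t Ht; destruct (E t Ht) as (_ & _ & <-); apply Hx1, Ht. }
  assert (HfM : forall t, 0 <= t <= T -> Rabs (f'' t) <= M).
  { intros t Ht; destruct (E t Ht) as (_ & _ & ->); apply (proj2 HM), Ht. }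
  assert (HM0 : 0 <= M)
    by (apply Rle_trans with (2 := HfM 0 ltac:(lra)); apply Rabs_pos).
  assert (HN : 1 <= INR N) by (apply (le_INR 1), hN).
  assert (Hdt : 0 < dt) by (apply Rdiv_lt_0_compat; lra).
  assert (HT : INR N * dt = T) by (unfold dt; field; lra).
  assert (Hgrid : forall j, (j <= N)%nat -> 0 <= grid dt j <= T).
  { intros j Hj; unfold grid; apply le_INR in Hj; pose proof (pos_INR j); nra. }
  assert (Cf' : forall x, continuous f' x).
  { intros x; apply continuity_pt_filterlim.
    apply is_derive_continuity_pt with (1 := Df' x). }
  assert (HCF : forall t, 0 <= t <= T -> CF_derivative T alpha h t =
      1 / (1 - alpha) *
      RInt (fun s => f' s * exp (- alpha * ((t - s) / (1 - alpha)))) 0 t).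
  { intros t Ht; unfold CF_derivative; f_equal; apply RInt_ext; intros s.
    rewrite Rmin_left, Rmax_right by lra; intros Hs.
    destruct (E s) as (_ & -> & _); [unfold Icc; lra|reflexivity]. }
  set (B := alpha * M / (8 * (1 - alpha) ^ 2) * dt ^ 2).
  assert (HB : 0 <= B).
  { apply Rmult_le_pos; [apply Rdiv_le_0_compat|]; nra. }
  (* The induction starts at [k = 0], where the integral over a point and the dummy value both
     vanish. *)
  assert (Hrec : forall k, (k <= N)%nat -> Rabs (Rk k) <= INR k * dt * B).
  { induction k as [|k IH]; intros Hk.
    - unfold Rk, CF_derivative, grid; simpl; rewrite !Rmult_0_l, RInt_point.
      change (zero : R) with 0; rewrite Rmult_0_r, Rminus_0_r, Rabs_R0; lra.
    - specialize (IH ltac:(lia)).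
      assert (Hstep : grid dt (S k) - grid dt k = dt)
        by (unfold grid; rewrite S_INR; ring).
      pose proof (Hgrid k ltac:(lia)) as Gk; pose proof (Hgrid (S k) Hk) as GSk.
      pose proof (cell_residual f f' f'' (grid dt k) (grid dt (S k)) M alpha
        halpha ltac:(lra) Df Df' ltac:(intros; apply HfM; lra)) as Hcell.
      destruct (E _ Gk) as (Ek & _), (E _ GSk) as (ESk & _).
      rewrite Hstep, Ek, ESk in Hcell.
      (* The memory factor is at most 1, so errors of earlier steps are not amplified and simply add
         up. *)
      assert (Hexp : 0 < exp (- (alpha * dt / (1 - alpha))) <= 1).
      { apply exp_nonpos_bounds.
        assert (0 <= alpha * dt / (1 - alpha)) by (apply Rdiv_le_0_compat; nra).
        lra. }
      set (q := exp (- (alpha * dt / (1 - alpha)))) in *.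
      match type of Hcell with Rabs ?X <= _ => set (D := X) in Hcell end.
      assert (HR : Rk (S k) = q * Rk k + 1 / (1 - alpha) * D).
      { unfold Rk; rewrite F_discrete_S, !HCF by assumption.
        rewrite (kernel_RInt_shift f' alpha 0 (grid dt k) (grid dt (S k)) Cf').
        rewrite Hstep; fold q; unfold D; ring. }
      assert (HDB : 1 / (1 - alpha) * (dt * (alpha / (1 - alpha) * (M / 8 * dt ^ 2)))
                    = dt * B) by (unfold B; field; lra).
      assert (0 < 1 / (1 - alpha)) by (apply Rdiv_lt_0_compat; lra).
      rewrite HR, S_INR; eapply Rle_trans; [apply Rabs_triang|].
      rewrite !Rabs_mult, (Rabs_pos_eq q), (Rabs_pos_eq (1 / (1 - alpha))) by lra.
      apply Rmult_le_compat_l with (r := 1 / (1 - alpha)) in Hcell; [|lra].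
      pose proof (Rabs_pos (Rk k)); nra. }
  intros k Hk; apply Rle_trans with (1 := Hrec k (proj2 Hk)).
  replace (alpha * T * M / (8 * (1 - alpha) ^ 2) * dt ^ 2) with (T * B)
    by (unfold B; field; lra).
  apply Rmult_le_compat_r; [exact HB|]; apply (Hgrid k), Hk.
Qed.
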